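(* Let $G\leq O(\mathbb{R}^n)$ be a finite subgroup preserving $\mathbb{Z}^n$. Then $G$ is a Weyl group if and only if there is a rational polyhedral cone $D\subset\mathbb{R}^n$ such that $D\cap\mathbb{Z}^n$ is a discrete strict fundamental domain for the $G$-action on $\mathbb{Z}^n$.
   Context: $O(\mathbb{R}^n)$ is the orthogonal group of $\mathbb{R}^n$. A subset $E\subset\mathbb{Z}^n$ is a discrete strict fundamental domain for the $G$-action on $\mathbb{Z}^n$ if the restriction to $E$ of the quotient map $\mathbb{Z}^n\to\mathbb{Z}^n/G$ is bijective, i.e. $E$ meets every $G$-orbit in $\mathbb{Z}^n$ in exactly one point. A rational polyhedral cone in $\mathbb{R}^n$ is a set of the form $\{x\in\mathbb{R}^n\mid \langle a_i,x\rangle\ge 0,\ i=1,\dots,k\}$ for finitely many $a_i\in\mathbb{Q}^n$ (equivalently, the set of nonnegative real linear combinations of finitely many vectors in $\mathbb{Q}^n$). A finite subgroup $G\leq O(\mathbb{R}^n)$ preserving the lattice $\mathbb{Z}^n$ is called a Weyl group if it is generated by (orthogonal, linear) reflections of $\mathbb{R}^n$ across hyperplanes through the origin. *)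

(* Defs.v *)
From mathcomp Require Import all_boot all_order all_algebra.
From mathcomp Require Import all_classical all_reals.
Set Implicit Arguments.
Unset Strict Implicit.
Unset Printing Implicit Defensive.
Import Order.TTheory GRing.Theory Num.Theory.
Local Open Scope classical_set_scope.
Local Open Scope ring_scope.

(* Vectors of R^n are column vectors, and linear maps of R^n are matrices
   acting on them on the left. *)

Definition inner (R : realType) (n : nat) (u v : 'cV[R]_n) : R :=
  \sum_(i < n) u i 0 * v i 0.

Definition integer_lattice (R : realType) (n : nat) : set 'cV[R]_n :=
  [set x | forall i, x i 0 \is a Num.int].

Definition orthogonal_group (R : realType) (n : nat) : set 'M[R]_n :=
  [set A | A^T *m A = 1%:M].

Definition orthogonal_subgroup (R : realType) (n : nat) (G : set 'M[R]_n) :=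
  [/\ G `<=` @orthogonal_group R n, G 1%:M,
      (forall A B, G A -> G B -> G (A *m B)) &
      (forall A, G A -> G (invmx A))].

Definition preserves_lattice (R : realType) (n : nat) (G : set 'M[R]_n) :=
  forall A, G A ->
    (mulmx A @` @integer_lattice R n) = @integer_lattice R n.

(* [reflection A]: A is the orthogonal reflection across the hyperplane
   through the origin with some normal vector v. *)
Definition reflection (R : realType) (n : nat) : set 'M[R]_n :=
  [set A | exists2 v : 'cV[R]_n, v != 0 &
    forall x : 'cV[R]_n, A *m x = x - (2 * inner v x / inner v v) *: v].

(* [smallest orthogonal_subgroup S] is the intersection of all subgroups of
   the orthogonal group containing S, i.e. the subgroup generated by S. *)
Definition weyl_group (R : realType) (n : nat) (G : set 'M[R]_n) :=
  exists2 S : set 'M[R]_n, S `<=` @reflection R n &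
    G = smallest (@orthogonal_subgroup R n) S.

Definition rational_polyhedral_cone (R : realType) (n : nat)
    (D : set 'cV[R]_n) :=
  exists (k : nat) (a : 'I_k -> 'cV[rat]_n),
    D = [set x | forall i, 0 <= inner (map_mx ratr (a i)) x].

Definition group_orbit (R : realType) (n : nat) (G : set 'M[R]_n)
    (x : 'cV[R]_n) : set 'cV[R]_n :=
  [set A *m x | A in G].

(* The quotient of the lattice by G is the set of orbits of lattice points,
   and the quotient map is [group_orbit G]. *)
Definition discrete_strict_fundamental_domain (R : realType) (n : nat)
    (G : set 'M[R]_n) (E : set 'cV[R]_n) :=
  E `<=` @integer_lattice R n /\
  set_bij E (group_orbit G @` @integer_lattice R n) (group_orbit G).

(* Main.v *)
(* If G is generated by reflections, take the unit normals of all reflections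
   in G and let D be the chamber cut out by the positive ones.  Each orbit
   meets D, at a maximum of a generic positive functional.  A root is simple
   when its reflection permutes the other positive roots; the reflections in
   simple roots generate G, and the exchange condition shows, by induction on
   word length, that an element of G mapping a point x of D into D fixes x.

   Conversely, D is a strict fundamental domain for the action on Q^n, by
   clearing denominators.  Take an irredundant system of inequalities for D and
   a rational point q in the relative interior of a facet with normal v.  Some
   A in G sends a point just outside D near q back into D; such an A fixes q and
   the hyperplane orthogonal to v, hence is the reflection in v.  For r interior
   to D with trivial stabilizer and A in G, choose B in the group generated by
   the facet reflections that maximizes <A r, B r>; then B^-1 A r lies in D, so
   it equals r, and A = B. *)
Require Import Defs.
From mathcomp Require Import all_boot all_order all_algebra.
From mathcomp Require Import all_classical all_reals.
From mathcomp Require Import ring lra.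
Import Order.TTheory GRing.Theory Num.Theory.
Local Open Scope classical_set_scope.
Local Open Scope ring_scope.

Set Implicit Arguments.
Unset Strict Implicit.
Unset Printing Implicit Defensive.

(* [inner] over an arbitrary ordered field: the converse implication is proved
   over [rat], which is not a [realType]. *)
Definition dot (F : realFieldType) (n : nat) (u v : 'cV[F]_n) : F :=
  \sum_(i < n) u i 0 * v i 0.

Definition refl (F : realFieldType) (n : nat) (v : 'cV[F]_n) : 'M[F]_n :=
  1%:M - (2 / dot v v) *: (v *m v^T).

(** * Finite maxima and uniformly small perturbations *)

Section Finite.

Variable F : realFieldType.

Lemma seq_argmax (T : eqType) (s : seq T) (f : T -> F) (x0 : T) :
  x0 \in s -> exists2 x, x \in s & {in s, forall y, f y <= f x}.
Proof.
elim: s x0 => [//|a s IH] x0 _.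
case: s IH => [_|b s /(_ b (mem_head _ _)) [x xs xmax]].
  by exists a => [|y]; rewrite ?mem_head // inE => /eqP ->.
case: (lerP (f a) (f x)) => h.
  by exists x => [|y]; rewrite inE ?xs ?orbT // => /predU1P[->//|/xmax].
exists a => [|y]; rewrite ?mem_head // inE => /predU1P[->//|/xmax hy].
exact: le_trans hy (ltW h).
Qed.

(** A single step size for finitely many affine functions: [p.1 + e * p.2] keeps the sign of [p.1]
    whenever [p.1] is nonzero. *)
Lemma small_eps (s : seq (F * F)) :
  exists2 e : F, 0 < e &
    {in s, forall p, p.1 != 0 -> `|e * p.2| < `|p.1|}.
Proof.
elim: s => [|[c d] s [e e0 he]]; first by exists 1.
have d1 : 0 < `|d| + 1 by rewrite ltr_wpDl.
have [->|c0] := eqVneq c 0.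
  by exists e => // p; rewrite inE => /predU1P[-> /=|/he//]; rewrite eqxx.
exists (Num.min e (`|c| / (`|d| + 1))).
  by rewrite lt_min e0 divr_gt0 // normr_gt0.
have m0 : 0 <= Num.min e (`|c| / (`|d| + 1)).
  by rewrite le_min ltW //= divr_ge0 // ltW.
move=> p; rewrite inE normrM ger0_norm // =>
  /predU1P[-> _ /=|/[dup] ps /he h /h].
  apply: (@le_lt_trans _ _ (`|c| / (`|d| + 1) * `|d|)).
    by rewrite ler_wpM2r // ge_min lexx orbT.
  rewrite mulrAC ltr_pdivrMr // mulrDr mulr1 ltrDl normr_gt0 //.
rewrite normrM (ger0_norm (ltW e0)); apply: le_lt_trans.
by rewrite ler_wpM2r // ge_min lexx.
Qed.

End Finite.

(** * Inner product, reflections and generic vectors *)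

Section Euclid.

Variables (F : realFieldType) (n : nat).
Implicit Types (u v x y : 'cV[F]_n) (A B : 'M[F]_n).

Lemma dotE u v : dot u v = (u^T *m v) 0 0.
Proof. by rewrite mxE; apply: eq_bigr => i _; rewrite mxE. Qed.

Lemma dotC u v : dot u v = dot v u.
Proof. by apply: eq_bigr => i _; rewrite mulrC. Qed.

Lemma dotDl u v x : dot (u + v) x = dot u x + dot v x.
Proof. by rewrite !dotE linearD mulmxDl mxE. Qed.

Lemma dotDr u v x : dot x (u + v) = dot x u + dot x v.
Proof. by rewrite !dotE mulmxDr mxE. Qed.

Lemma dotZl c u x : dot (c *: u) x = c * dot u x.
Proof. by rewrite !dotE linearZ -scalemxAl mxE. Qed.

Lemma dotZr c u x : dot x (c *: u) = c * dot x u.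
Proof. by rewrite dotC dotZl dotC. Qed.

Lemma dotNl u x : dot (- u) x = - dot u x.
Proof. by rewrite -scaleN1r dotZl mulN1r. Qed.

Lemma dotNr u x : dot x (- u) = - dot x u.
Proof. by rewrite -scaleN1r dotZr mulN1r. Qed.

Lemma dotBl u v x : dot (u - v) x = dot u x - dot v x.
Proof. by rewrite dotDl dotNl. Qed.

Lemma dotBr u v x : dot x (u - v) = dot x u - dot x v.
Proof. by rewrite dotDr dotNr. Qed.

Lemma dot0l x : dot 0 x = 0.
Proof. by rewrite -(scale0r 0) dotZl mul0r. Qed.

Lemma dotMl A u v : dot (A *m u) v = dot u (A^T *m v).
Proof. by rewrite !dotE trmx_mul mulmxA. Qed.

Lemma dotMr A u v : dot u (A *m v) = dot (A^T *m u) v.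
Proof. by rewrite dotMl trmxK. Qed.

Lemma dot_ge0 u : 0 <= dot u u.
Proof. by apply: sumr_ge0 => i _; rewrite -expr2 sqr_ge0. Qed.

Lemma dot_eq0 u : (dot u u == 0) = (u == 0).
Proof.
rewrite /dot psumr_eq0; last by move=> i _; rewrite -expr2 sqr_ge0.
apply/allP/eqP => [u0|-> i _]; last by rewrite mxE mul0r eqxx.
apply/colP => i; rewrite mxE; apply/eqP.
by have := u0 i (mem_index_enum _); rewrite mulf_eq0 orbb.
Qed.

Lemma dot_gt0 u : (0 < dot u u) = (u != 0).
Proof. by rewrite lt0r dot_ge0 dot_eq0 andbT. Qed.

Lemma mulmx_ext A B : (forall x, A *m x = B *m x) -> A = B.
Proof.
move=> AB; apply/matrixP => i j.
have := congr1 (fun x : 'cV_n => x i 0) (AB (delta_mx j 0)).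
by rewrite -!colE !mxE.
Qed.

Lemma reflE v x : refl v *m x = x - (2 * dot v x / dot v v) *: v.
Proof.
rewrite mulmxBl mul1mx -scalemxAl -mulmxA [v^T *m x]mx11_scalar -dotE.
by rewrite mul_mx_scalar scalerA; congr (_ - _ *: _); rewrite mulrAC.
Qed.

Lemma refl_tr v : (refl v)^T = refl v.
Proof. by rewrite linearB /= trmx1 linearZ /= trmx_mul trmxK. Qed.

Lemma refl_fix v x : dot v x = 0 -> refl v *m x = x.
Proof. by move=> vx; rewrite reflE vx mulr0 mul0r scale0r subr0. Qed.

Lemma refl_self v : v != 0 -> refl v *m v = - v.
Proof.
rewrite -dot_eq0 => v0; rewrite reflE mulfK // scaler_nat mulr2n.
by rewrite opprD addrA subrr sub0r.
Qed.

Lemma refl_invol v : v != 0 -> refl v *m refl v = 1%:M.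
Proof.
move=> v0; apply: mulmx_ext => x; rewrite -mulmxA mul1mx [in LHS](reflE v x).
rewrite mulmxBr -scalemxAr refl_self // scalerN opprK reflE.
by rewrite subrK.
Qed.

Lemma reflZ c v : c != 0 -> refl (c *: v) = refl v.
Proof.
move=> c0; have [->|] := eqVneq v 0; first by rewrite scaler0.
rewrite -dot_eq0 => v0; apply: mulmx_ext => x.
rewrite !reflE !dotZl !dotZr scalerA; congr (_ - _ *: _).
by field; rewrite c0 v0.
Qed.

Lemma reflN v : refl (- v) = refl v.
Proof. by rewrite -scaleN1r reflZ // oppr_eq0 oner_eq0. Qed.

Lemma dot_ortho A u v : A^T *m A = 1%:M -> dot (A *m u) (A *m v) = dot u v.
Proof. by move=> h; rewrite dotMl mulmxA h mul1mx. Qed.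

Lemma refl_conj A v : A^T *m A = 1%:M -> refl (A *m v) = A *m refl v *m A^T.
Proof.
move=> h; have h' := mulmx1C h; apply: mulmx_ext => x.
rewrite -!mulmxA !reflE dot_ortho // dotMl.
by rewrite mulmxBr -scalemxAr mulmxA h' mul1mx.
Qed.

(** Since [refl v] sends [u] to [- u], the vector [u] is a multiple of [v], and unit length leaves
    only the factors 1 and -1. *)
Lemma refl_unit_inj u v : dot u u = 1 -> dot v v = 1 -> refl u = refl v ->
  u = v \/ u = - v.
Proof.
move=> u1 v1 uv; have := refl_self (v := u); rewrite -dot_eq0 u1 oner_eq0.
move=> /(_ isT); rewrite uv reflE v1 divr1 => h.
have {h}uE : u = dot v u *: v.
  have : 2 *: u = (2 * dot v u) *: v.
    have -> : (2 * dot v u) *: v = u - (u - (2 * dot v u) *: v).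
      by rewrite opprB addrC subrK.
    by rewrite h opprK scaler_nat mulr2n.
  by rewrite -scalerA => /(scalerI (_ : 2 != 0)); apply; rewrite pnatr_eq0.
have : dot v u ^+ 2 = 1.
  by rewrite -u1 [in RHS]uE dotZl dotZr v1 mulr1 expr2.
move=> /eqP; rewrite sqrf_eq1 => /orP[] /eqP h; rewrite uE h.
  by left; rewrite scale1r.
by right; rewrite scaleN1r.
Qed.

(** The hyperplanes of [Q] are avoided one at a time: a point on the hyperplane of [u] is moved
    along [u], by a step too small to disturb the conditions already secured. *)
Lemma generic_perturbation (P Q : seq 'cV[F]_n) r0 :
  {in P, forall v, 0 < dot v r0} ->
  exists r, {in P, forall v, 0 < dot v r} /\
            {in Q, forall v, v != 0 -> dot v r != 0}.
Proof.
move=> Pr0; elim: Q => [|u Q [r [Pr Qr]]]; first by exists r0.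
have [u0|u0] := eqVneq u 0.
  by exists r; split=> // v; rewrite inE => /predU1P[->|/Qr//]; rewrite u0 eqxx.
have [ur|ur] := eqVneq (dot u r) 0; last first.
  by exists r; split=> // v; rewrite inE => /predU1P[->|/Qr].
have [e e0 he] := small_eps [seq (dot v r, dot v u) | v <- P ++ Q].
have {}he v : v \in P ++ Q -> dot v r != 0 -> `|e * dot v u| < `|dot v r|.
  by move=> vPQ; apply: (he (_, _)); apply/mapP; exists v.
exists (r + e *: u); split=> v.
  move=> vP; have v0 := Pr v vP; have := he v; rewrite mem_cat vP gt_eqF //.
  rewrite (gtr0_norm v0) => /(_ isT isT); rewrite ltr_norml dotDr dotZr.
  by move=> /andP[h _]; lra.
rewrite inE dotDr dotZr => /predU1P[-> _|vQ v0].
  by rewrite ur add0r mulf_eq0 dot_eq0 (negPf u0) gt_eqF.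
have := he v; rewrite mem_cat vQ orbT => /(_ isT (Qr _ vQ v0)).
by apply: contraTneq => /eqP; rewrite addr_eq0 => /eqP ->; rewrite normrN ltxx.
Qed.

End Euclid.

(** * From a fundamental cone to generation by its facet reflections *)

Section ConeToWeyl.

Variables (F : realFieldType) (n : nat).

Definition dual_cone (a : seq 'cV[F]_n) (x : 'cV[F]_n) :=
  {in a, forall v, 0 <= dot v x}.

(** An inequality that no point violates alone follows from the others. Dropping all copies of it
    shortens the list and keeps the cone. *)
Lemma irredundant_facets (a : seq 'cV[F]_n) :
  exists b, (forall x, dual_cone b x <-> dual_cone a x) /\
    {in b, forall v, exists2 x, dot v x < 0 &
                     {in b, forall u, u != v -> 0 <= dot u x}}.
Proof.
have [m] := ubnP (size a); elim: m a => // m IH a am.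
have [facets|/existsNP[v /not_implyP[va /forall2NP nofacet]]] := pselect
  {in a, forall v, exists2 x, dot v x < 0 &
                     {in a, forall u, u != v -> 0 <= dot u x}}.
  by exists a.
have [|b [ba facets]] := IH [seq u <- a | u != v].
  rewrite size_filter -ltnS; apply: leq_trans am; rewrite ltnS.
  rewrite -(count_predC (pred1 v) a) -[ltnLHS]add0n ltn_add2r.
  by rewrite -has_count has_pred1.
exists b; split=> // x; rewrite ba; split=> [ax|ax u]; last first.
  by rewrite mem_filter => /andP[_ /ax].
have axv u : u \in a -> u != v -> 0 <= dot u x.
  by move=> ua uv; apply: ax; rewrite mem_filter uv.
move=> u ua; have [->|] := eqVneq u v; last exact: axv.
by have [/negP|[]] := nofacet x; rewrite -?leNgt.
Qed.

Variables (G : seq 'M[F]_n) (a : seq 'cV[F]_n).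
Hypothesis G_ortho : {in G, forall A, A^T *m A = 1%:M}.
Hypothesis G_one : 1%:M \in G.
Hypothesis G_mul : {in G &, forall A B, A *m B \in G}.
Hypothesis G_tr : {in G, forall A, A^T \in G}.
Hypothesis G_meets : forall x, exists2 A, A \in G & dual_cone a (A *m x).
Hypothesis G_unique : forall x, {in G, forall A,
  dual_cone a x -> dual_cone a (A *m x) -> A *m x = x}.
Hypothesis a_facets : {in a, forall v, exists2 x, dot v x < 0 &
  {in a, forall u, u != v -> 0 <= dot u x}}.

Lemma facet_neq0 v : v \in a -> v != 0.
Proof.
by move=> /a_facets[x vx _]; apply: contraTneq vx => ->; rewrite dot0l ltxx.
Qed.

Lemma generic_interior_point : exists2 r, {in a, forall v, 0 < dot v r} &
  {in G, forall A, A *m r = r -> A = 1%:M}.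
Proof.
(* The first family keeps every image of the point off the walls; the second, made of the rows of
   [A - 1], prevents any [A] other than the identity from fixing it. *)
pose Q := [seq A^T *m v | A <- G, v <- a] ++
  [seq (row i (A - 1%:M))^T | A <- G, i <- enum 'I_n].
have [//|x [_ Qx]] := @generic_perturbation F n [::] Q 0.
have [A AG ax] := G_meets x; exists (A *m x).
  move=> v va; rewrite lt0r ax // andbT dotMr; apply: Qx.
    by rewrite mem_cat; apply/orP; left; apply/allpairsP; exists (A, v).
  apply: contraNneq (facet_neq0 va) => /(congr1 (mulmx A)).
  by rewrite mulmxA (mulmx1C (G_ortho AG)) mul1mx mulmx0 => /eqP.
move=> B BG; rewrite mulmxA => BAx.
have h C : C \in G -> C *m x = x -> C = 1%:M.
  move=> CG Cx; apply/eqP; rewrite -subr_eq0; apply/eqP/row_matrixP => i.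
  rewrite row0; apply/eqP; rewrite -trmx_eq0.
  apply/negPn/negP => /Qx; rewrite mem_cat => /(_ _)/negP; apply.
    apply/orP; right; apply/allpairsP; exists (C, i).
    by split=> //=; rewrite mem_enum.
  rewrite dotE trmxK -row_mul mulmxBl Cx mul1mx subrr row0 mxE //.
(* The stabilizer of [A *m x] is conjugate by [A] to that of [x], hence trivial. *)
have := h (A^T *m B *m A); rewrite !G_mul ?G_tr // => /(_ isT).
rewrite -!mulmxA [B *m _]mulmxA BAx mulmxA (G_ortho AG) mul1mx => /(_ erefl).
move=> /(congr1 (fun M => A *m M *m A^T)); rewrite mulmx1.
rewrite !mulmxA (mulmx1C (G_ortho AG)) mul1mx -mulmxA.
by rewrite (mulmx1C (G_ortho AG)) mulmx1.
Qed.

Lemma facet_reflection v : v \in a -> refl v \in G.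
Proof.
move=> va; have v0 := facet_neq0 va; have [r ar _] := generic_interior_point.
have [x vx ax] := a_facets va.
(* Up to a positive scalar, the point where the segment from [r] to [x] crosses the hyperplane of
   [v]. Both coefficients are positive, so every other inequality is strict at [q]. *)
pose q := dot v r *: x - dot v x *: r.
have vq : dot v q = 0 by rewrite dotBr !dotZr mulrC subrr.
have aq u : u \in a -> u != v -> 0 < dot u q.
  move=> ua uv; have := ax u ua uv; have := ar u ua; have := ar v va.
  by rewrite dotBr !dotZr => *; nra.
have q_cone : dual_cone a q.
  by move=> u ua; have [->|uv] := eqVneq u v; rewrite ?vq // ltW // aq.
(* A point [q - e v] just outside the facet is brought back into the cone by
   some [A]; for [e] small enough this forces [A *m q] into the cone, so [A]
   fixes [q]. *)
have [e e0 he] := small_eps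
  [seq (dot u (A *m q), dot u (A *m v)) | A <- G, u <- a].
have [A AG aA] := G_meets (q - e *: v).
have {he} Aq : A *m q = q.
  apply: G_unique => // u ua; rewrite leNgt; apply/negP => uq.
  have := he (dot u (A *m q), dot u (A *m v)).
  move=> /(_ _ _)/= h; have {h}: `|e * dot u (A *m v)| < `|dot u (A *m q)|.
    by apply: h; [apply/allpairsP; exists (A, u) | rewrite lt_eqF].
  have := aA u ua; rewrite mulmxBr -scalemxAr dotBr dotZr.
  by rewrite (ltr0_norm uq) ltr_norml => + /andP[]; lra.
have A1 : A != 1%:M.
  apply/eqP => A1; have := aA v va; rewrite A1 mul1mx dotBr dotZr vq sub0r.
  by rewrite oppr_ge0 pmulr_rle0 // leNgt dot_gt0 v0.
(* For small [d], the point [q + d *: u] and its image [q + d *: (A *m u)] both lie in the cone, so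
   they coincide. The inequality of [v] at the image needs [dot v (A *m u)] nonnegative, arranged by
   changing the sign of [u]. *)
have A_fix u : dot v u = 0 -> A *m u = u.
  wlog vAu : u / 0 <= dot v (A *m u).
    move=> fix_nneg vu; have [|/ltW vAu] := lerP 0 (dot v (A *m u)).
      by move/fix_nneg; apply.
    apply: oppr_inj; rewrite -mulmxN fix_nneg //.
      by rewrite mulmxN dotNr oppr_ge0.
    by rewrite dotNr vu oppr0.
  move=> vu.
  have [d d0 hd] := small_eps ([seq (dot w q, dot w u) | w <- a] ++
                               [seq (dot w q, dot w (A *m u)) | w <- a]).
  have q_near y w : w \in a -> w != v -> y = u \/ y = A *m u ->
      0 <= dot w (q + d *: y).
    move=> wa wv yE; rewrite dotDr dotZr.
    have := hd (dot w q, dot w y); rewrite mem_cat /= (gtr0_norm (aq w wa wv)).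
    rewrite (gt_eqF (aq w wa wv)) ltr_norml => /(_ _ isT) h.
    suff /andP[] : - dot w q < d * dot w y < dot w q by lra.
    by apply: h; case: yE => ->; apply/orP; [left|right];
      apply/mapP; exists w.
  have Aqdu : A *m (q + d *: u) = q + d *: (A *m u).
    by rewrite mulmxDr -scalemxAr Aq.
  have : A *m (q + d *: u) = q + d *: u.
    apply: G_unique => // w wa; have [->|wv] := eqVneq w v.
    - by rewrite dotDr dotZr vq vu mulr0 addr0.
    - by apply: q_near => //; left.
    - by rewrite Aqdu dotDr dotZr vq add0r mulr_ge0 // ltW.
    - by rewrite Aqdu; apply: q_near => //; right.
  by rewrite Aqdu => /addrI/(scalerI _); apply; rewrite gt_eqF.
have vv0 : dot v v != 0 by rewrite dot_eq0.
(* As [A] is an isometry fixing the hyperplane pointwise, it scales its normal by some [k] with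
   [k ^+ 2 = 1]; [k = 1] would make [A] the identity. *)
pose k := dot v (A *m v) / dot v v.
have Av : A *m v = k *: v.
  apply/eqP; rewrite -subr_eq0; set y := _ - _.
  have vy : dot v y = 0 by rewrite dotBr dotZr divfK // subrr.
  rewrite -dot_eq0 {2}/y dotBr dotZr (dotC y v) vy mulr0 subr0.
  by rewrite -{1}(A_fix y vy) dot_ortho ?G_ortho // dotC vy.
have AE x0 : A *m x0 = x0 + ((k - 1) * (dot v x0 / dot v v)) *: v.
  set c := dot v x0 / dot v v.
  have x0E : x0 = (x0 - c *: v) + c *: v by rewrite subrK.
  rewrite {1}x0E mulmxDr A_fix; last first.
    by rewrite dotBr dotZr divfK // subrr.
  rewrite -scalemxAr Av scalerA -addrA; congr (_ + _).
  by rewrite -scaleNr -scalerDl; congr (_ *: _); ring.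
have : k ^+ 2 = 1.
  apply: (mulIf vv0); rewrite mul1r expr2 -mulrA -dotZr -dotZl -Av.
  by rewrite dot_ortho ?G_ortho.
move=> /eqP; rewrite sqrf_eq1 => /orP[]/eqP k1.
  case/eqP: A1; apply: mulmx_ext => y.
  by rewrite AE k1 subrr mul0r scale0r addr0 mul1mx.
suff -> : refl v = A by [].
apply: mulmx_ext => y; rewrite AE reflE k1 -scaleNr.
by congr (_ + _ *: _); field.
Qed.

(** [H] is left arbitrary so that it can be the preimage under [map_mx ratr] of a subgroup of real
    matrices. *)
Lemma generated_by_facet_reflections (H : set 'M[F]_n) :
  H 1%:M -> (forall A B, H A -> H B -> H (A *m B)) ->
  {in a, forall v, H (refl v)} -> {in G, forall A, H A}.
Proof.
move=> H1 HM Ha A AG; have [r ar r_free] := generic_interior_point.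
have [|B] := @seq_argmax F _ [seq B <- G | `[< H B >]]
  (fun B => dot (A *m r) (B *m r)) 1%:M.
  by rewrite mem_filter G_one andbT; apply/asboolP.
rewrite mem_filter => /andP[/asboolP HB BG] Bmax.
have r_cone : dual_cone a r by move=> v /ar/ltW.
have BA : B^T *m A = 1%:M.
  apply: r_free; first by rewrite G_mul // G_tr.
  apply: G_unique => //; first by rewrite G_mul // G_tr.
  (* Comparing [B] with [B *m refl v] shows that [dot v r * dot (A *m r) (B *m v)] is nonnegative.
     Since [dot v r] is positive, this is the inequality of [v] at [B^T *m A *m r]. *)
  move=> v va; rewrite -mulmxA dotMr trmxK dotC.
  have := Bmax (B *m refl v).
  rewrite mem_filter G_mul ?facet_reflection // andbT.
  move=> /(_ (asboolT (HM _ _ HB (Ha v va)))).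
  rewrite -mulmxA reflE mulmxBr dotBr -scalemxAr dotZr lerBlDr lerDl.
  have vv : 0 < dot v v by rewrite dot_gt0 facet_neq0.
  by rewrite pmulr_rge0 // divr_gt0 // mulr_gt0 // ar.
by rewrite -[A]mul1mx -(mulmx1C (G_ortho BG)) -mulmxA BA mulmx1.
Qed.

End ConeToWeyl.

(** * Roots, simple roots and the chamber of a reflection group *)

Lemma unit_roots (F : realFieldType) (n : nat) (G : seq 'M[F]_n) :
  exists P : seq 'cV[F]_n,
    forall v, v \in P <-> dot v v = 1 /\ refl v \in G.
Proof.
elim: G => [|A G [P PE]].
  by exists [::] => v; rewrite !in_nil; split=> [|[]].
(* Each matrix contributes at most one pair of opposite unit normals. *)
have [[r [r1 rA]]|no_root] := pselect (exists r, dot r r = 1 /\ refl r = A).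
  exists [:: r, - r & P] => v; rewrite !inE; split.
    case/or3P => [/eqP->|/eqP->|/PE[v1 vG]]; last by rewrite vG orbT.
      by rewrite rA eqxx.
    by rewrite reflN rA eqxx dotNl dotNr opprK.
  move=> [v1 /predU1P[vA|vG]]; last first.
    by have /PE -> : dot v v = 1 /\ refl v \in G by []; rewrite !orbT.
  have [->|->] := refl_unit_inj v1 r1 (etrans vA (esym rA)).
    by rewrite eqxx.
  by rewrite eqxx orbT.
exists P => v; rewrite PE inE; split=> [[-> ->]|[v1]]; first by rewrite orbT.
by case/predU1P => // vA; case: no_root; exists v.
Qed.

Section WeylToCone.

Variables (F : realFieldType) (n : nat) (G : seq 'M[F]_n) (P : seq 'cV[F]_n)
  (r0 : 'cV[F]_n).
Hypothesis G_ortho : {in G, forall A, A^T *m A = 1%:M}.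
Hypothesis G_one : 1%:M \in G.
Hypothesis G_mul : {in G &, forall A B, A *m B \in G}.
Hypothesis G_tr : {in G, forall A, A^T \in G}.
Hypothesis PE : forall v,
  v \in P <-> [/\ dot v v = 1, refl v \in G & 0 < dot v r0].
Hypothesis r0_generic : forall v, dot v v = 1 -> refl v \in G -> dot v r0 != 0.

Lemma pos_root_unit v : v \in P -> dot v v = 1.
Proof. by case/PE. Qed.

Lemma pos_root_refl v : v \in P -> refl v \in G.
Proof. by case/PE. Qed.

Lemma pos_root_gt0 v : v \in P -> 0 < dot v r0.
Proof. by case/PE. Qed.

Lemma pos_root_neq0 v : v \in P -> v != 0.
Proof. by move/pos_root_unit => v1; rewrite -dot_eq0 v1 oner_eq0. Qed.

(** The reflection in [A *m v] is the conjugate of [refl v] by [A], so [A *m v] is again a root, and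
    genericity of [r0] gives it a sign. *)
Lemma pos_root_act v A : v \in P -> A \in G -> A *m v \in P \/ - (A *m v) \in P.
Proof.
move=> /PE[v1 vG _] AG.
have Av1 : dot (A *m v) (A *m v) = 1 by rewrite dot_ortho ?G_ortho.
have AvG : refl (A *m v) \in G by rewrite refl_conj ?G_ortho // !G_mul ?G_tr.
have := r0_generic Av1 AvG; rewrite neq_lt => /orP[] h; [right|left]; apply/PE.
  by rewrite dotNl dotNr opprK reflN dotNl oppr_gt0.
by [].
Qed.

Lemma pos_root_colinear u v c : u \in P -> v \in P -> u = c *: v -> u = v.
Proof.
move=> uP vP uE; have : c ^+ 2 = 1.
  have := pos_root_unit uP; rewrite uE dotZl dotZr pos_root_unit // mulr1.
  by rewrite expr2.
move=> /eqP; rewrite sqrf_eq1 => /orP[]/eqP c1; first by rewrite uE c1 scale1r.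
have := pos_root_gt0 uP; rewrite uE c1 dotZl mulN1r oppr_gt0.
by rewrite lt_gtF // pos_root_gt0.
Qed.

Definition simple_root v :=
  v \in P /\ {in P, forall u, u != v -> refl v *m u \in P}.

(* Moving from a generic point [r] of the chamber towards [x], the first
   reflecting hyperplane met is a wall of the chamber, and the point where it
   is met lies on no other reflecting hyperplane. *)
Lemma simple_root_separating x v : v \in P -> dot v x < 0 ->
  exists2 s, simple_root s & dot s x < 0.
Proof.
move=> vP vx.
(* Genericity against these combinations forbids two distinct positive roots from having the same
   nonzero ratio [dot u x / dot u r], so no two hyperplanes are met at the same point on the way to
   [x]. *)
have [//|r [rP rQ]] := @generic_perturbation F n P
  [seq dot u x *: w - dot w x *: u | u <- P, w <- P] r0.
  exact: pos_root_gt0.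
have [s sP smax] := seq_argmax (fun u => - (dot u x / dot u r)) vP.
have {}smax u : u \in P -> dot s x / dot s r <= dot u x / dot u r.
  by move=> /smax; rewrite lerN2.
have sx : dot s x < 0.
  have := le_lt_trans (smax v vP) (_ : dot v x / dot v r < 0).
  rewrite pmulr_llt0 ?invr_gt0 ?rP // pmulr_llt0 ?invr_gt0 ?rP //.
  exact.
exists s => //; split=> // u uP us.
pose p := dot s r *: x - dot s x *: r.
have sp : dot s p = 0 by rewrite dotBr !dotZr mulrC subrr.
have pE w : dot w p = dot s r * dot w x - dot s x * dot w r.
  by rewrite dotBr !dotZr.
have p_ge0 w : w \in P -> 0 <= dot w p.
  move=> wP; rewrite pE subr_ge0 -ler_pdivlMr ?rP //.
  by rewrite -[leRHS]mulrA -ler_pdivrMl ?rP // mulrC smax.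
have up : 0 < dot u p.
  rewrite lt0r p_ge0 // andbT pE.
  have := rQ (dot u x *: s - dot s x *: u); rewrite dotBl !dotZl => h.
  rewrite mulrC h //; first by apply/allpairsP; exists (u, s).
  rewrite subr_eq0; apply: contra_neq us => uE.
  apply: (@pos_root_colinear _ _ (dot u x / dot s x)) => //.
  apply: (scalerI (ltr0_neq0 sx)); rewrite -uE scalerA mulrC divfK //.
  exact: ltr0_neq0.
(* Were [refl s *m u] negative, its opposite would be nonnegative at [p]; but [refl s] fixes [p], so
   its value there is [- dot u p], which is negative. *)
have [//|suP] := pos_root_act uP (pos_root_refl sP).
have := p_ge0 _ suP; rewrite dotNl dotMl refl_tr refl_fix //.
by rewrite oppr_ge0 leNgt up.
Qed.

Fixpoint word (w : seq 'cV[F]_n) : 'M[F]_n :=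
  if w is s :: w' then refl s *m word w' else 1%:M.

Lemma word_cat w1 w2 : word (w1 ++ w2) = word w1 *m word w2.
Proof. by elim: w1 => [|s w1 IH] /=; rewrite ?mul1mx // IH mulmxA. Qed.

Definition simple_word (w : seq 'cV[F]_n) := forall s, s \in w -> simple_root s.

Lemma simple_word_cons s w :
  simple_word (s :: w) <-> simple_root s /\ simple_word w.
Proof.
split=> [sw|[ss ww] u]; last by rewrite inE => /predU1P[->|/ww].
by split=> [|u uw]; apply: sw; rewrite inE ?eqxx ?uw ?orbT.
Qed.

Lemma word_in w : simple_word w -> word w \in G.
Proof.
elim: w => [//|s w IH] /simple_word_cons[[sP _] /IH wG] /=.
by rewrite G_mul // pos_root_refl.
Qed.

(* In a counterexample [v] of least height [dot v r0], reflecting [v] in a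
   simple root [s] with [dot s v > 0] lowers its height. *)
Lemma refl_word v : v \in P -> exists2 w, simple_word w & refl v = word w.
Proof.
move=> v1P; apply: contrapT => no_word.
pose bad := [seq u <- P | `[< ~ exists2 w, simple_word w & refl u = word w >]].
have : v \in bad by rewrite mem_filter v1P andbT; apply/asboolP.
move=> /(seq_argmax (fun u => - dot u r0)) {v v1P no_word} [v].
rewrite mem_filter => /andP[/asboolP no_word vP] vmin; apply: no_word.
have [|s [sP s_perm]] := @simple_root_separating (- v) v vP.
  by rewrite dotNr pos_root_unit // oppr_lt0.
rewrite dotNr oppr_lt0 => sv.
have [->|vs] := eqVneq v s.
  by exists [:: s]; [apply/simple_word_cons | rewrite /= mulmx1].
have svP := s_perm v vP vs.
have s_lower : dot (refl s *m v) r0 < dot v r0.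
  rewrite reflE (pos_root_unit sP) divr1 dotBl dotZl ltrBlDr ltrDl.
  by rewrite !mulr_gt0 ?pos_root_gt0.
have [w ww wE] : exists2 w, simple_word w & refl (refl s *m v) = word w.
  apply: contrapT => no_word; have := vmin (refl s *m v).
  rewrite mem_filter svP andbT lerN2 leNgt s_lower.
  by move=> /(_ (asboolT no_word)).
(* [refl v] is the conjugate by [refl s] of the reflection in the lower root. *)
exists (s :: rcons w s).
  by move=> u; rewrite inE mem_rcons inE orbA orbb => /predU1P[->|/ww].
rewrite /= -cats1 word_cat /= mulmx1 -wE.
rewrite refl_conj; last by rewrite refl_tr refl_invol // pos_root_neq0.
rewrite refl_tr -!mulmxA refl_invol ?pos_root_neq0 // mulmx1 mulmxA.
by rewrite refl_invol ?pos_root_neq0 // mul1mx.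
Qed.

(** Reading [w] from the left, [v] is replaced by [refl s *m v], which stays positive until [v]
    equals the letter [s]; there the two reflections cancel. A sign change must occur, so such a
    letter exists. *)
Lemma word_exchange v w : v \in P -> simple_word w ->
  - ((word w)^T *m v) \in P ->
  exists w', [/\ simple_word w', (size w' < size w)%N &
                refl v *m word w = word w'].
Proof.
elim: w v => [|s w IH] v vP /=.
  move=> _; rewrite trmx1 mul1mx => /pos_root_gt0; rewrite dotNl oppr_gt0.
  by rewrite lt_gtF // pos_root_gt0.
move=> /simple_word_cons[ss ww]; have [->|vs] := eqVneq v s.
  move=> _; exists w; split=> //.
  by rewrite mulmxA refl_invol ?mul1mx // pos_root_neq0 //; case: ss.
rewrite trmx_mul refl_tr -mulmxA.
have svP : refl s *m v \in P by case: ss => _; apply.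
move=> /(IH _ svP ww)[w' [ww' ltw' w'E]].
exists (s :: w'); split=> //; first exact/simple_word_cons.
have s0 : s != 0 by case: ss => /pos_root_neq0.
rewrite /= -w'E refl_conj ?refl_tr ?refl_invol // !mulmxA.
by rewrite refl_invol // mul1mx.
Qed.

Definition chamber (x : 'cV[F]_n) := {in P, forall v, 0 <= dot v x}.

Lemma chamber_word_fixed x w : simple_word w -> chamber x ->
  chamber (word w *m x) -> word w *m x = x.
Proof.
move=> + cx; have [m] := ubnP (size w); elim: m w => // m IH [|s w] /= wm.
  by rewrite mul1mx.
move=> /[dup] sww /simple_word_cons[[sP _] ww] cy.
have s0 := pos_root_neq0 sP.
(* If [(word w)^T *m s] is negative, the exchange condition shortens the word. *)
have [wsP|wsP] := pos_root_act sP (G_tr (word_in ww)); last first.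
  have [w' [ww' ltw' w'E]] := word_exchange sP ww wsP.
  rewrite w'E in cy *; apply: IH => //; exact: leq_trans ltw' (ltnW wm).
have sy : dot s (word w *m x) = 0.
  apply/eqP; rewrite eq_le dotMr cx // andbT -dotMr.
  have := cy s sP; rewrite -mulmxA dotMr refl_tr refl_self // dotNl oppr_ge0.
  by [].
rewrite -mulmxA refl_fix // in cy *; apply: IH => //.
Qed.

(** At a point of the orbit of greatest height [dot _ r0], a positive root with negative value would
    give a reflection raising the height. *)
Lemma chamber_meets x : exists2 A, A \in G & chamber (A *m x).
Proof.
have [A AG Amax] := seq_argmax (fun A : 'M_n => dot (A *m x) r0) G_one.
exists A => // v vP; have := Amax (refl v *m A).
rewrite G_mul ?pos_root_refl // => /(_ isT).
rewrite -mulmxA reflE (pos_root_unit vP) divr1 dotBl dotZl gerDl oppr_le0.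
by rewrite -mulrA pmulr_rge0 // pmulr_lge0 // pos_root_gt0.
Qed.

End WeylToCone.

(** * Passage between real and rational vectors and matrices *)

Lemma rational_mx (R : realType) (m n : nat) (A : 'M[R]_(m, n)) :
  (forall i j, A i j \is a Num.int) ->
  exists M : 'M[rat]_(m, n), map_mx ratr M = A.
Proof.
move=> AZ; exists (map_mx (fun x => (Num.floor x)%:~R) A).
apply/matrixP => i j; rewrite !mxE ratr_int.
by apply/eqP; rewrite -intrEfloor.
Qed.

Lemma reflectionE (R : realType) (n : nat) (A : 'M[R]_n) :
  reflection A <-> exists2 v, v != 0 & A = refl v.
Proof.
split=> -[v v0 AE]; exists v => //; last by move=> x; rewrite AE reflE.
by apply: mulmx_ext => x; rewrite AE reflE.
Qed.

Lemma invmx_ortho (R : realType) (n : nat) (A : 'M[R]_n) :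
  A^T *m A = 1%:M -> invmx A = A^T.
Proof.
move=> h; have Au : A \in unitmx by case: (mulmx1_unit h).
by rewrite -[RHS](mulmxK Au) h mul1mx.
Qed.

Lemma clear_denominators (n : nat) (x : 'cV[rat]_n) :
  exists2 N : rat, 0 < N & forall i, (N *: x) i 0 \is a Num.int.
Proof.
exists (\prod_i (denq (x i 0))%:~R).
  by apply: prodr_gt0 => i _; rewrite ltr0z denq_gt0.
move=> i; rewrite mxE (bigD1 i) //= mulrAC [X in X * _]mulrC.
rewrite -numqE rpredM ?intr_int //.
by apply: rpred_prod => j _; rewrite intr_int.
Qed.

Lemma ratr_dot (R : realType) (n : nat) (u v : 'cV[rat]_n) :
  inner (map_mx ratr u) (map_mx ratr v) = ratr (dot u v) :> R.
Proof.
by rewrite rmorph_sum; apply: eq_bigr => i _; rewrite !mxE rmorphM.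
Qed.

Lemma map_refl (R : realType) (n : nat) (v : 'cV[rat]_n) :
  map_mx ratr (refl v) = refl (map_mx ratr v) :> 'M[R]_n.
Proof.
rewrite /refl map_mxB map_mx1 map_mxZ map_mxM map_trmx.
by rewrite fmorph_div /= -ratr_dot rmorph_nat.
Qed.

(** * Finite groups preserving the lattice, and the two implications *)

Section LatticeGroup.

Variables (R : realType) (n : nat) (G : set 'M[R]_n) (s : seq 'M[R]_n).
Hypothesis GE : G = [set` s].
Hypothesis G_subgroup : orthogonal_subgroup G.
Hypothesis G_lattice : preserves_lattice G.

Lemma group_mem A : G A <-> A \in s.
Proof. by rewrite GE. Qed.

Lemma group_ortho A : G A -> A^T *m A = 1%:M.
Proof. by case: G_subgroup => + _ _ _; apply. Qed.

Lemma group_one : G 1%:M.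
Proof. by case: G_subgroup. Qed.

Lemma group_mul A B : G A -> G B -> G (A *m B).
Proof. by case: G_subgroup => _ _ + _; apply. Qed.

Lemma group_tr A : G A -> G A^T.
Proof.
move=> GA; rewrite -invmx_ortho; first by case: G_subgroup => _ _ _; apply.
exact: group_ortho.
Qed.

Lemma group_lattice A x : G A -> integer_lattice x -> integer_lattice (A *m x).
Proof. by move=> GA; rewrite -{2}(G_lattice GA) => xZ; exists x. Qed.

(** The columns of [A] are the images of the standard basis vectors, which are lattice points. *)
Lemma group_int A i j : G A -> A i j \is a Num.int.
Proof.
move=> GA; have := @group_lattice A (delta_mx j 0) GA.
rewrite -colE => /(_ _ i); rewrite mxE; apply=> k.
by rewrite mxE rpred_nat.
Qed.

Lemma orbit_act A x : G A -> group_orbit G (A *m x) = group_orbit G x.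
Proof.
move=> GA; apply/seteqP; split=> _ [B GB <-].
  by exists (B *m A); rewrite ?mulmxA //; exact: group_mul.
exists (B *m A^T); first exact/group_mul/group_tr.
by rewrite -mulmxA [A^T *m _]mulmxA group_ortho // mul1mx.
Qed.

(** The first clause is surjectivity onto the set of orbits, the second injectivity. *)
Lemma strict_fundamental_domainP (D : set 'cV[R]_n) :
  discrete_strict_fundamental_domain G (D `&` @integer_lattice R n) <->
  (forall x, integer_lattice x -> exists2 A, G A & D (A *m x)) /\
  (forall x A, integer_lattice x -> G A -> D x -> D (A *m x) -> A *m x = x).
Proof.
split=> [[_ [_ Dinj Dsurj]]|[Dmeets Dunique]].
  split=> [x xZ|x A xZ GA Dx DAx].
    have [|y [Dy _] yx] := Dsurj (group_orbit G x); first by exists x.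
    have : group_orbit G y y by exists 1%:M; rewrite ?mul1mx //; exact: group_one.
    by rewrite yx => -[A GA Ax]; exists A; rewrite ?Ax.
  by apply: Dinj; rewrite ?inE ?orbit_act //; split=> //; exact: group_lattice.
split=> [x []//|]; split=> [x [_ xZ]|x y|_ [x xZ <-]].
- by exists x.
- rewrite !inE => -[Dx xZ] [Dy _] xy.
  have : group_orbit G y y by exists 1%:M; rewrite ?mul1mx //; exact: group_one.
  by rewrite -xy => -[A GA Ax]; rewrite -Ax; symmetry; apply: Dunique; rewrite ?Ax.
- have [A GA DAx] := Dmeets x xZ; exists (A *m x); last exact: orbit_act.
  by split=> //; exact: group_lattice.
Qed.

Lemma group_rational A : G A -> exists M : 'M[rat]_n, map_mx ratr M = A.
Proof. by move=> GA; apply: rational_mx => i j; exact: group_int. Qed.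

Lemma rational_group : exists s' : seq 'M[rat]_n,
  forall M, M \in s' <-> G (map_mx ratr M).
Proof.
have fP A : exists M : 'M[rat]_n, G A -> map_mx ratr M = A.
  have [/group_rational[M MA]|] := pselect (G A); first by exists M.
  by exists 0.
have [f fK] := choice fP.
exists (map f s) => M; split=> [/mapP[A /group_mem GA ->]|GM].
  by rewrite fK.
apply/mapP; exists (map_mx ratr M); first exact/group_mem.
by apply: (@map_mx_inj _ R ratr); rewrite fK.
Qed.

Lemma cone_to_weyl (D : set 'cV[R]_n) : rational_polyhedral_cone D ->
  discrete_strict_fundamental_domain G (D `&` @integer_lattice R n) ->
  weyl_group G.
Proof.
move=> [k [a DE]] /strict_fundamental_domainP[Dmeets Dunique].
have [s' s'E] := rational_group.
have [b [ba b_facets]] := irredundant_facets [seq a i | i <- enum 'I_k].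
have Dcone x : D (map_mx ratr x) <-> dual_cone b x.
  rewrite ba DE; split=> [Dx _ /mapP[i _ ->]|cx i].
    by have := Dx i; rewrite ratr_dot ler0q.
  by rewrite ratr_dot ler0q; apply: cx; apply: map_f; rewrite mem_enum.
(* Invariance under positive scaling carries existence and uniqueness from lattice points to all
   rational points. *)
have coneZ N x : 0 < N -> dual_cone b (N *: x) <-> dual_cone b x.
  by move=> N0; split=> cx v /cx; rewrite dotZr pmulr_rge0.
have lattice_map (x : 'cV[rat]_n) : (forall i, x i 0 \is a Num.int) ->
    integer_lattice (map_mx ratr x : 'cV[R]_n).
  by move=> xZ i; rewrite mxE; have /intrP[m ->] := xZ i; rewrite ratr_int
    intr_int.
have s'_ortho : {in s', forall A, A^T *m A = 1%:M}.
  move=> A /s'E/group_ortho; rewrite map_trmx -map_mxM -(map_mx1 ratr).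
  exact: map_mx_inj.
have s'_one : 1%:M \in s' by apply/s'E; rewrite map_mx1; exact: group_one.
have s'_mul : {in s' &, forall A B, A *m B \in s'}.
  by move=> A B /s'E GA /s'E GB; apply/s'E; rewrite map_mxM; exact: group_mul.
have s'_tr : {in s', forall A, A^T \in s'}.
  by move=> A /s'E GA; apply/s'E; rewrite -map_trmx; exact: group_tr.
have s'_meets x : exists2 A, A \in s' & dual_cone b (A *m x).
  have [N N0 NxZ] := clear_denominators x.
  have [A GA DAx] := Dmeets _ (lattice_map _ NxZ).
  have [M MA] := group_rational GA.
  exists M; first by apply/s'E; rewrite MA.
  by apply/(coneZ N) => //; rewrite scalemxAr; apply/Dcone; rewrite map_mxM MA.
have s'_unique x : {in s', forall A,
    dual_cone b x -> dual_cone b (A *m x) -> A *m x = x}.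
  move=> A /s'E GA /(coneZ _ _ _)cx cAx.
  have [N N0 NxZ] := clear_denominators x.
  apply: (scalerI (lt0r_neq0 N0)); apply: (@map_mx_inj _ R ratr).
  rewrite scalemxAr map_mxM; apply: Dunique => //.
  - exact: lattice_map.
  - exact/Dcone/cx.
  - by rewrite -map_mxM; apply/Dcone; rewrite -scalemxAr; apply/coneZ.
(* All reflections of [G] serve as generators; the facet reflections are among them. *)
exists (G `&` @reflection R n); first by move=> A [].
apply/seteqP; split=> [A GA H [H_subgroup GH]|]; last first.
  by apply: smallest_sub => // A [].
have [_ H1 HM _] := H_subgroup.
have [M MA] := group_rational GA.
rewrite -MA; apply: (generated_by_facet_reflections s'_ortho s'_one s'_mul
  s'_tr s'_meets s'_unique b_facets (H := fun M => H (map_mx ratr M))).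
- by rewrite map_mx1.
- by move=> B C HB HC; rewrite map_mxM; exact: HM.
- move=> v vb; apply: GH; split.
    by apply/s'E; apply: (facet_reflection s'_ortho s'_mul s'_tr s'_meets
      s'_unique b_facets vb).
  apply/reflectionE; exists (map_mx ratr v); last exact: map_refl.
  by rewrite map_mx_eq0 (facet_neq0 b_facets).
- by apply/s'E; rewrite MA.
Qed.

Lemma weyl_to_cone : weyl_group G -> exists2 D : set 'cV[R]_n,
  rational_polyhedral_cone D &
  discrete_strict_fundamental_domain G (D `&` @integer_lattice R n).
Proof.
move=> [S S_refl GS].
have [roots rootsE] := unit_roots s.
have [//|r [_ r_roots]] := @generic_perturbation R n [::] roots 0.
have r_generic v : dot v v = 1 -> refl v \in s -> dot v r != 0.
  move=> v1 vG; apply: r_roots; first exact/rootsE.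
  by rewrite -dot_eq0 v1 oner_eq0.
pose P := [seq v <- roots | 0 < dot v r].
have PE v : v \in P <-> [/\ dot v v = 1, refl v \in s & 0 < dot v r].
  rewrite mem_filter; split=> [/andP[vr /rootsE[]]//|[v1 vG ->]].
  exact/rootsE.
have s_ortho : {in s, forall A, A^T *m A = 1%:M}.
  by move=> A /group_mem/group_ortho.
have s_one : 1%:M \in s by exact/group_mem/group_one.
have s_mul : {in s &, forall A B, A *m B \in s}.
  by move=> A B /group_mem GA /group_mem GB; exact/group_mem/group_mul.
have s_tr : {in s, forall A, A^T \in s}.
  by move=> A /group_mem GA; exact/group_mem/group_tr.
have S_G A : S A -> G A by move=> SA; rewrite GS; exact: sub_gen_smallest.
have word_refl w : simple_word P w -> (word w)^T = word (rev w).
  elim: w => [|v w IH] /=; first by rewrite trmx1.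
  move=> /simple_word_cons[_ /IH wE].
  by rewrite trmx_mul refl_tr wE rev_cons -cats1 word_cat /= mulmx1.
(* Words in simple reflections form an orthogonal subgroup, inversion being reversal of the word,
   and this subgroup contains [S]. *)
have G_word A : G A -> exists2 w, simple_word P w & A = word w.
  rewrite GS; apply: (smallest_sub
    (X := [set A | exists2 w, simple_word P w & A = word w])) => [|{}A SA]/=.
    split.
    - by move=> _ [w ww ->]; apply/s_ortho/(word_in s_one s_mul PE).
    - by exists [::].
    - move=> _ _ [w ww ->] [w' ww' ->]; exists (w ++ w'); rewrite ?word_cat //.
      by move=> v; rewrite mem_cat => /orP[/ww|/ww'].
    - move=> _ [w ww ->]; rewrite invmx_ortho; last first.
        exact/s_ortho/(word_in s_one s_mul PE).
      exists (rev w); last exact: word_refl.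
      by move=> v; rewrite mem_rev => /ww.
  have /reflectionE[v v0 AE] := S_refl _ SA.
  have vv0 : 0 < dot v v by rewrite dot_gt0.
  pose c := (Num.sqrt (dot v v))^-1; pose u := c *: v.
  have c0 : c != 0 by rewrite invr_eq0 gt_eqF // sqrtr_gt0.
  have u1 : dot u u = 1.
    by rewrite dotZl dotZr mulrA -expr2 exprVn sqr_sqrtr ?mulVf ?gt_eqF // ltW.
  have uA : refl u = A by rewrite reflZ.
  have uG : refl u \in s by rewrite uA; exact/group_mem/S_G.
  have := r_generic u u1 uG; rewrite neq_lt -uA => /orP[] ur.
    rewrite -reflN; apply: (refl_word s_ortho s_mul s_tr PE r_generic).
    by apply/PE; rewrite dotNl dotNr opprK reflN dotNl oppr_gt0.
  by apply: (refl_word s_ortho s_mul s_tr PE r_generic); apply/PE.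
have P_rational v : v \in P -> exists (q : 'cV[rat]_n) (c : R),
    0 < c /\ map_mx ratr q = c *: v.
  move=> vP; have v0 := pos_root_neq0 PE vP.
  have [i vi] : exists i, v i 0 != 0.
    apply: contrapT => /forallNP vi; case/eqP: v0; apply/colP => i.
    by rewrite mxE; apply/eqP/negPn/negP/vi.
  (* For a unit root, [1 - refl v] has entries [2 * v j 0 * v i 0], which are integers. The absolute
     value keeps the factor positive, so scaling preserves the inequality of [v]. *)
  have vZ j : 2 * `|v i 0| * v j 0 \is a Num.int.
    have /PE[v1 /group_mem vG _] := vP.
    have := rpredB (_ : (1%:M : 'M[R]_n) j i \is a Num.int) (group_int j i vG).
    rewrite [refl v j i]mxE !mxE big_ord1 mxE v1 divr1 opprB addrC subrK.
    rewrite rpred_nat => /(_ isT) vvZ.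
    have [_|_] := ger0P (v i 0).
      by have -> : 2 * v i 0 * v j 0 = 2 * (v j 0 * v i 0) by ring.
    have -> : 2 * - v i 0 * v j 0 = - (2 * (v j 0 * v i 0)) by ring.
    by rewrite rpredN.
  have [|q qE] := @rational_mx R _ _ ((2 * `|v i 0|) *: v).
    by move=> j k; rewrite ord1 mxE.
  exists q, (2 * `|v i 0|).
  by split; first by rewrite mulr_gt0 // normr_gt0.
have [Q QP] : exists Q : seq 'cV[rat]_n, forall x : 'cV[R]_n,
    chamber P x <-> {in Q, forall q, 0 <= inner (map_mx ratr q) x}.
  elim: P P_rational {PE r_generic G_word word_refl} => [_|v P' IH P_rat].
    by exists [::].
  have [w wP'|Q QP] := IH; first by apply: P_rat; rewrite inE wP' orbT.
  have [|q [c [c0 qE]]] := P_rat v; first exact: mem_head.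
  exists (q :: Q) => x.
  have qx : 0 <= inner (map_mx ratr q) x <-> 0 <= dot v x.
    by rewrite qE -[inner _ _]/(dot _ _) dotZl pmulr_rge0.
  split=> [cx p|cx w].
    rewrite inE => /predU1P[->|]; first by apply/qx/cx/mem_head.
    by move: p; apply/QP => w wP'; apply: cx; rewrite inE wP' orbT.
  rewrite inE => /predU1P[->|]; first by apply/qx/cx/mem_head.
  by move: w; apply/QP => p pQ; apply: cx; rewrite inE pQ orbT.
exists [set x | chamber P x].
  exists (size Q), (tnth (in_tuple Q)); apply/seteqP; split=> x /=.
    by move=> /QP cx i; apply/cx/mem_tnth.
  by move=> cx; apply/QP => q /(tnthP (in_tuple Q))[i ->].
apply/strict_fundamental_domainP; split=> [x _|x A _ /G_word[w ww ->]] /=.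
  have [A /group_mem GA cA] := chamber_meets s_one s_mul PE x.
  by exists A.
exact: (chamber_word_fixed s_ortho s_one s_mul s_tr PE r_generic).
Qed.

End LatticeGroup.

Theorem corollary9 (R : realType) (n : nat) (G : set 'M[R]_n)
    (G_subgroup : orthogonal_subgroup G) (G_finite : finite_set G)
    (G_lattice : preserves_lattice G) :
  weyl_group G <->
  exists2 D : set 'cV[R]_n, rational_polyhedral_cone D &
    discrete_strict_fundamental_domain G (D `&` @integer_lattice R n).
Proof.
have /finite_seqP[s GE] := G_finite.
split; first exact: (weyl_to_cone GE).
move=> [D D_cone D_dom].
exact: (cone_to_weyl GE G_subgroup G_lattice D_cone).
Qed.
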